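(* Let $1\leq q_{1}<q_{2}\leq p<\infty$. Then $WM^{p}_{q_{2}}\subset M^{p}_{q_{1}}$, and for every $f\in WM^{p}_{q_2}$, $$\|f\|_{M^{p}_{q_{1}}}\leq 2\Big(\frac{q_{1}}{q_{2}-q_{1}}\Big)^{1/q_{2}}\|f\|_{WM^{p}_{q_{2}}}.$$
   Context: All function spaces are over $\mathbb{R}^n$ and consist of measurable functions. $Q(x,r)$ denotes the open cube centered at $x\in\mathbb{R}^n$ with side length $2r$, and $|E|$ denotes the Lebesgue measure of $E$. For $1\leq q\leq p<\infty$, the Morrey space $M^{p}_{q}$ is the set of functions $f$ with $$\|f\|_{M^{p}_{q}}:=\sup_{x\in\mathbb{R}^{n},\,r>0}\frac{1}{|Q(x,r)|^{1/q-1/p}}\bigg(\int_{Q(x,r)}|f(y)|^{q}\,dy\bigg)^{1/q}<\infty,$$ and the weak Morrey space $WM^{p}_{q}$ is the set of functions $f$ with $$\|f\|_{WM^{p}_{q}}:=\sup_{x\in\mathbb{R}^{n},\,r>0}\frac{1}{|Q(x,r)|^{1/q-1/p}}\sup_{\lambda>0}\Big(\lambda^{q}\,|\{y\in Q(x,r):|f(y)|>\lambda\}|\Big)^{1/q}<\infty.$$ *)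

(* Defs.v *)
From HB Require Import structures.
From mathcomp Require Import all_boot all_order all_algebra.
From mathcomp Require Import all_classical all_reals all_analysis.

Set Implicit Arguments.
Unset Strict Implicit.
Unset Printing Implicit Defensive.

Import Order.TTheory GRing.Theory Num.Theory.
Import numFieldNormedType.Exports.

Local Open Scope classical_set_scope.
Local Open Scope ring_scope.
Local Open Scope ereal_scope.

(* MathComp-Analysis provides Lebesgue measure only on the real line. On R^n
   it is built here as the n-fold product of the one-dimensional measure (on
   the Borel sets of n.-tuple R), completed by Caratheodory extension. *)

Section product_cons.
Context d (T : measurableType d) (R : realType) (n : nat).

Definition tuple_cons (z : T * n.-tuple T) : n.+1.-tuple T :=
  [the n.+1.-tuple T of z.1 :: z.2].

Lemma measurable_tuple_cons : measurable_fun [set: T * n.-tuple T] tuple_cons.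
Proof. exact: measurable_cons. Qed.

Variables (m1 : {sigma_finite_measure set T -> \bar R})
  (m2 : {sigma_finite_measure set (n.-tuple T) -> \bar R}).

Definition product_cons : set (n.+1.-tuple T) -> \bar R :=
  pushforward (m1 \x m2) tuple_cons.

(* the measure structure of a pushforward is found only with this hint *)
#[local] Hint Resolve measurable_tuple_cons : core.

Let product_cons0 : product_cons set0 = 0.
Proof. exact: measure0. Qed.

Let product_cons_ge0 A : 0 <= product_cons A.
Proof. exact: measure_ge0. Qed.

Let product_cons_sigma_additive : semi_sigma_additive product_cons.
Proof. exact: measure_semi_sigma_additive. Qed.

HB.instance Definition _ := isMeasure.Build _ _ _ product_cons
  product_cons0 product_cons_ge0 product_cons_sigma_additive.

Let product_cons_sigma_finite : sigma_finite setT product_cons.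
Proof.
have /sigma_finiteP[F [TF ndF Foo]] := sigma_finiteT m1.
have /sigma_finiteP[G [TG ndG Goo]] := sigma_finiteT m2.
pose g (t : n.+1.-tuple T) : T * n.-tuple T := (thead t, [tuple of behead t]).
have mg : measurable_fun [set: n.+1.-tuple T] g.
  apply/measurable_fun_pair => /=; first exact: measurable_tnth.
  exact: measurable_behead.
have gK z : g (tuple_cons z) = z.
  by case: z => x t; congr pair; exact/val_inj.
exists (fun k => g @^-1` (F k `*` G k)).
  rewrite -preimage_bigcup (_ : \bigcup_k _ = setT) ?preimage_setT//.
  rewrite -subTset => -[x y] _.
  have [i _ Fx] : (\bigcup_k F k) x by rewrite -TF.
  have [j _ Gy] : (\bigcup_k G k) y by rewrite -TG.
  exists (maxn i j) => //; split => /=.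
    by move: x Fx; exact/subsetPset/ndF/leq_maxl.
  by move: y Gy; exact/subsetPset/ndG/leq_maxr.
move=> k; have [mF Fk] := Foo k; have [mG Gk] := Goo k; split.
  by rewrite -[X in measurable X]setTI; apply: mg => //; exact: measurableX.
rewrite /product_cons /pushforward (_ : tuple_cons @^-1` _ = F k `*` G k).
  by rewrite product_measure1E// lte_mul_pinfty// ge0_fin_numE.
by apply/seteqP; split=> z; rewrite /preimage /mkset gK.
Qed.

HB.instance Definition _ := Measure_isSigmaFinite.Build _ _ _ product_cons
  product_cons_sigma_finite.

End product_cons.

Fixpoint borel_lebesgue (R : realType) (n : nat) :
    {sigma_finite_measure set (n.-tuple (measurableTypeR R)) -> \bar R} :=
  match n with
  | 0%N => dirac [tuple]
  | m.+1 => product_cons lebesgue_measure (borel_lebesgue R m)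
  end.

(* R^n, equipped with the sigma-algebra of Lebesgue measurable sets *)
Definition euclidean (R : realType) (n : nat) : measurableType _ :=
  caratheodory_type (borel_lebesgue R n)^*%mu.

Definition lebesgue (R : realType) (n : nat) : set (euclidean R n) -> \bar R :=
  @completed_measure_extension _ _ R (borel_lebesgue R n).

HB.instance Definition _ (R : realType) (n : nat) :=
  Measure.on (@lebesgue R n).

Section morrey.
Context (R : realType) (n : nat).
Let Rn := euclidean R n.
Let mu := @lebesgue R n.
Implicit Types (p q r l : R) (x y : Rn) (f : Rn -> R).

Definition cube x r : set Rn :=
  [set y | forall i, (`|(tnth y i : R) - (tnth x i : R)| < r)%R].

Definition morrey_norm p q f : \bar R :=
  ereal_sup [set (mu (cube x r) `^ (q^-1 - p^-1))^-1 *
      (\int[mu]_(y in cube x r) (`|f y| `^ q)%:E) `^ q^-1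
    | x in [set: Rn] & r in [set r : R | (0 < r)%R]].

Definition weak_morrey_norm p q f : \bar R :=
  ereal_sup [set (mu (cube x r) `^ (q^-1 - p^-1))^-1 *
      ereal_sup [set ((l `^ q)%:E *
          mu [set y | cube x r y /\ (l < `|f y|)%R]) `^ q^-1
        | l in [set l : R | (0 < l)%R]]
    | x in [set: Rn] & r in [set r : R | (0 < r)%R]].

Definition morrey p q : set (Rn -> R) :=
  [set f | measurable_fun setT f /\ morrey_norm p q f < +oo].

Definition weak_morrey p q : set (Rn -> R) :=
  [set f | measurable_fun setT f /\ weak_morrey_norm p q f < +oo].

End morrey.

(* Main.v *)
Require Import Defs.
From HB Require Import structures.
From mathcomp Require Import all_boot all_order all_algebra.
From mathcomp Require Import all_classical all_reals all_analysis.
From mathcomp Require Import measurable_realfun ring.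

Set Implicit Arguments.
Unset Strict Implicit.
Unset Printing Implicit Defensive.

Import Order.TTheory GRing.Theory Num.Theory.
Import numFieldNormedType.Exports.

Local Open Scope classical_set_scope.
Local Open Scope ring_scope.

(** Work on one cube [Q] of volume [V], and write [W] for the supremum over
    [l > 0] of [l * mu {y in Q | |f y| > l} ^ (1 / q2)].  The two norms are
    suprema over the cubes of [V ^ (1 / p - 1 / q1)] times the [L^q1] norm of
    [f] on [Q], and of [V ^ (1 / p - 1 / q2)] times [W].  So it is enough to
    prove on each [Q] the embedding of weak [L^q2] into [L^q1],

      (int_Q |f|^q1)^(1 / q1) <=
        2 (q1 / (q2 - q1))^(1 / q2) W V^(1 / q1 - 1 / q2),

    which holds on every set of finite measure
    ([Lebesgue_le_weak_Lebesgue]).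

    Replacing [f] by [h = |f|^q1] reduces to the exponents [1] and
    [s = q2 / q1 > 1].  By the layer cake formula, [int_Q h] is the integral
    over [t >= 0] of [mu {y in Q | h y > t}] ([layer_cake]).  Below a height
    [a] this measure is at most [V], and above it the weak bound
    [(B / t)^s], with [B = W^q1], is integrable because [s > 1].  Hence
    [int_Q h <= a V + B^s a^(1 - s) / (s - 1)] ([weak_type_integral_le]).
    The value of [a] that makes the two terms equal gives
    [int_Q h <= 2 (s - 1)^(- 1 / s) B V^(1 - 1 / s)]
    ([weak_type_integral_balanced]).  After taking the [q1]-th root,
    [(s - 1)^-1 = q1 / (q2 - q1)] appears with exponent [1 / q2], and the
    factor [2^(1 / q1)] is at most [2]. *)

(** * The layer cake formula *)

Section layer_cake.
Context d (T : measurableType d) (R : realType).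
Variable mu : {sigma_finite_measure set T -> \bar R}.
Variables (D : set T) (h : T -> R).
Hypotheses (mD : measurable D) (mh : measurable_fun setT h).
Hypothesis (h0 : forall x, 0 <= h x).

Let hypograph : set (T * measurableTypeR R) :=
  [set z | D z.1 /\ (0 <= z.2 /\ z.2 < h z.1)].

Let measurable_hypograph : measurable hypograph.
Proof.
rewrite (_ : hypograph = (D `*` setT) `&`
    ((fun z => 0 <= z.2) @^-1` [set true] `&`
     (fun z => z.2 < h z.1) @^-1` [set true])); last first.
  by apply/seteqP; split=> z /=; rewrite /hypograph/=;
    [move=> [? []]|move=> [[? _] []]].
apply: measurableI; first exact: measurableX.
apply: measurableI; rewrite -[X in measurable X]setTI.
  have : measurable_fun setT (fun z : T * measurableTypeR R => 0 <= z.2).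
    exact: measurable_fun_ler.
  exact.
have : measurable_fun setT (fun z : T * measurableTypeR R => z.2 < h z.1).
  by apply: measurable_fun_ltr => //; exact: measurableT_comp.
exact.
Qed.

Let section_hypograph t : 0 <= t ->
  (fun x => hypograph (x, t)) = D `&` [set x | t < h x].
Proof.
by move=> t0; apply/seteqP; split=> x; rewrite /hypograph/=;
  [move=> [? []]|move=> []].
Qed.

Let measurable_hyp :
  measurable_fun setT (fun z => (\1_hypograph z)%:E : \bar R).
Proof. exact/measurable_EFinP/measurable_indic. Qed.

Let integral_section (t : R) : 0 <= t ->
  (\int[mu]_x (\1_hypograph (x, t))%:E = mu (D `&` [set x | (t < h x)%R]))%E.
Proof.
move=> t0; rewrite -section_hypograph// -[X in _ = mu X]setIT.
rewrite -(integral_indic _ measurableT)//.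
rewrite section_hypograph//; apply: measurableI => //.
rewrite -[X in measurable X]setTI.
rewrite (_ : [set x | t < h x] = (fun x => t < h x) @^-1` [set true])//.
have : measurable_fun setT (fun x => t < h x).
  exact: measurable_fun_ltr.
exact.
Qed.

(** Measurability of the distribution function of [h], for splitting and
    comparing integrals over the height [t]. *)
Lemma measurable_fun_superlevel :
  measurable_fun (`[0%R, +oo[%classic : set (measurableTypeR R))
    (fun t => mu (D `&` [set x | t < h x])).
Proof.
apply: (eq_measurable_fun (fun t : R => \int[mu]_x (\1_hypograph (x, t))%:E)%E).
  by move=> t; rewrite inE/= in_itv/= andbT => /integral_section.
apply: measurable_funTS.
apply: (measurable_fun_fubini_tonelli_G _ measurable_hyp).
by move=> z; rewrite lee_fin.
Qed.

(** Both sides compute the measure of the region of [D * R] between [0] and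
    the graph of [h], sliced vertically or horizontally (Tonelli). *)
Lemma layer_cake :
  (\int[mu]_(x in D) (h x)%:E =
   \int[lebesgue_measure]_(t in `[0%R, +oo[)
     mu (D `&` [set x | (t < h x)%R]))%E.
Proof.
transitivity (\int[mu]_x \int[lebesgue_measure]_t (\1_hypograph (x, t))%:E)%E.
  rewrite integral_mkcond; apply: eq_integral => x _.
  rewrite patchE; case: ifPn => [/set_mem Dx|Dx].
    transitivity (\int[lebesgue_measure]_t
        (\1_(`[0%R, h x[%classic : set R) t)%:E)%E.
      rewrite integral_indic// setIT.
      apply/esym; apply: etrans (lebesgue_measure_itv `[0%R, h x[) _ => /=.
      rewrite lte_fin -EFinD subr0.
      case: ltP => // hx0; congr EFin; apply/le_anti; by rewrite hx0 h0.
    apply: eq_integral => t _; congr EFin.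
    rewrite !indicE; congr (nat_of_bool _)%:R.
    by apply/idP/idP; rewrite !inE/= /hypograph/= in_itv/=;
      [move=> /andP[]|move=> [_ [-> ->]]].
  rewrite integral0_eq// => t _; rewrite indicE memNset//.
  by rewrite /hypograph/= => -[/mem_set]; rewrite (negbTE Dx).
rewrite (fubini_tonelli (fun z => (\1_hypograph z)%:E))//.
rewrite [RHS]integral_mkcond; apply: eq_integral => t _.
rewrite patchE; case: ifPn => [/set_mem|tD].
  by rewrite /= in_itv/= andbT => t0; rewrite integral_section.
rewrite integral0_eq// => x _; rewrite indicE memNset//.
by move=> [_ [/= t0 _]]; move: tD; rewrite notin_setE/= in_itv/= t0.
Qed.

End layer_cake.

(** * Tail integrals of powers *)

Lemma cvg_powRN_pinfty (R : realType) (a : R) : 0 < a ->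
  x `^ (- a) @[x --> +oo] --> (0 : R).
Proof.
move=> a0; apply/cvgrPdist_le => e e0; near=> x.
have x0 : 0 < x by near: x; exact: nbhs_pinfty_gt.
rewrite sub0r normrN ger0_norm ?powR_ge0// powRN invf_ple ?posrE ?powR_gt0//.
have -> : e^-1 = (e^-1 `^ a^-1) `^ a.
  by rewrite -powRrM mulVf ?gt_eqF// powRr1// invr_ge0 ltW.
apply: ge0_ler_powR; rewrite ?nnegrE ?powR_ge0 ?(ltW a0) ?(ltW x0)//.
Unshelve. all: end_near. Qed.

(** The primitive [t^(1 - s) / (1 - s)] vanishes at infinity. *)
Lemma integral_powRN_tail (R : realType) (s a : R) : 1 < s -> 0 < a ->
  (\int[lebesgue_measure]_(t in `[a, +oo[) (t `^ (- s))%:E =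
   (a `^ (1 - s) / (s - 1))%:E)%E.
Proof.
move=> s1 a0.
have s10 : 1 - s != 0 by rewrite subr_eq0 lt_eqF.
have cF x : 0 < x -> derivable (fun t : R => (1 - s)^-1 * t `^ (1 - s)) x 1.
  move=> x0; apply: derivableM => //; apply: derivable_powR.
  by rewrite in_itv/= x0.
rewrite (@ge0_continuous_FTC2y R _ (fun t => (1 - s)^-1 * t `^ (1 - s)) _ 0).
- rewrite -EFinB sub0r; congr EFin; rewrite mulrC -mulrN -invrN opprB//.
- by move=> x _; exact: powR_ge0.
- apply: derivable_within_continuous => x; rewrite in_itv/= andbT => ax.
  by apply: derivable_powR; rewrite in_itv/= andbT (lt_le_trans a0).
- rewrite -[X in _ --> X](mulr0 (1 - s)^-1); apply: cvgM; first exact: cvg_cst.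
  rewrite -[1 - s]opprB; apply: cvg_powRN_pinfty; rewrite subr_gt0//.
- by move=> x ax; apply: cF; exact: lt_trans ax.
- apply: cvg_at_right_filter.
  by have /derivable1_diffP/differentiable_continuous := cF _ a0.
- move=> x; rewrite in_itv/= andbT => ax.
  have x0 : 0 < x := lt_trans a0 ax.
  have := is_derive1_powR (1 - s) x0 => dF.
  rewrite derive1E deriveM//= derive_val derive_cst scaler0 addr0.
  rewrite scalerA mulVf// scale1r; congr (_ `^ _); ring.
Qed.

(** * Integrals of functions of weak type *)

Section weak_type.
Context d (T : measurableType d) (R : realType).
Variable mu : {sigma_finite_measure set T -> \bar R}.
Variables (D : set T) (h : T -> R).
Hypotheses (mD : measurable D) (mh : measurable_fun setT h).
Hypothesis (h0 : forall x, 0 <= h x).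

(** In the layer cake formula, [mu D] bounds the slices at heights [t < a] and
    the weak-type hypothesis those at heights [t >= a]; the latter bound is
    integrable at infinity because [s > 1]. *)
Lemma weak_type_integral_le (s B a : R) : 1 < s -> 0 <= B -> 0 < a ->
  (forall t : R, (0 < t)%R ->
    mu (D `&` [set x | (t < h x)%R]) <= ((B / t) `^ s)%:E)%E ->
  (\int[mu]_(x in D) (h x)%:E <=
   a%:E * mu D + (B `^ s * (a `^ (1 - s) / (s - 1)))%:E)%E.
Proof.
move=> s1 B0 a0 weak; rewrite layer_cake//.
have mF := measurable_fun_superlevel mu mD mh.
have mt (t : R) : measurable (D `&` [set x | t < h x]).
  apply: measurableI => //; rewrite -[X in measurable X]setTI.
  rewrite (_ : [set x | t < h x] = h @^-1` `]t, +oo[).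
    exact: mh.
  by apply/seteqP; split => x /=; rewrite in_itv/= andbT.
have a_itv : (`[0%R, +oo[ = `[0%R, a[ `|` `[a, +oo[)%classic.
  by rewrite -itv_bndbnd_setU// bnd_simp ltW.
rewrite a_itv ge0_integral_setU//; last 2 first.
- by rewrite -a_itv.
- rewrite disj_set2E; apply/eqP/seteqP; split=> x //=; rewrite !in_itv/= andbT.
  by move=> [/andP[_ xa]]; rewrite leNgt xa.
have [mF1 mF2] :
    measurable_fun `[0%R, a[ (fun t => mu (D `&` [set x | t < h x])) /\
    measurable_fun `[a, +oo[ (fun t => mu (D `&` [set x | t < h x])).
  by move: mF; rewrite a_itv measurable_funU.
apply: leeD.
- apply: (@le_trans _ _
      (\int[lebesgue_measure]_(t in `[0%R, a[) (cst (mu D)) t)%E).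
    apply: ge0_le_integral => //.
    by move=> t _ /=; rewrite le_measure ?inE//; apply: subIsetl.
  have <- : lebesgue_measure (`[0%R, a[%classic : set R) = a%:E.
    by rewrite lebesgue_measure_itv/= lte_fin a0 -EFinB subr0.
  by rewrite integral_cst// muleC.
- have mpow : measurable_fun (`[a, +oo[%classic : set (measurableTypeR R))
      (fun t : R => (t `^ (- s))%:E).
    by apply/measurable_EFinP; apply: measurable_funTS; exact: measurable_powR.
  rewrite EFinM -integral_powRN_tail// -ge0_integralZl//; last 2 first.
  + by move=> *; rewrite lee_fin powR_ge0.
  + by rewrite lee_fin powR_ge0.
  apply: ge0_le_integral => //; first exact: measurable_funeM.
  move=> t /=; rewrite in_itv/= andbT => at_.
  have t0 := lt_le_trans a0 at_.
  rewrite -EFinM -mulN1r powRrM powR_inv1 ?(ltW t0)//.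
  rewrite -powRM ?invr_ge0 ?(ltW t0)//.
  exact: weak.
Qed.

(** The previous bound at the height [a] where its two terms are equal,
    namely [a = (s - 1)^(- 1 / s) B V^(- 1 / s)]. *)
Lemma weak_type_integral_balanced (s B V : R) : 1 < s -> 0 <= B ->
  mu D = V%:E ->
  (forall t : R, (0 < t)%R ->
    mu (D `&` [set x | (t < h x)%R]) <= ((B / t) `^ s)%:E)%E ->
  (\int[mu]_(x in D) (h x)%:E <=
   (2 * ((s - 1)^-1 `^ s^-1 * B * V `^ (1 - s^-1)))%:E)%E.
Proof.
move=> s1 B0 muD weak.
have s0 : 0 < s := lt_trans ltr01 s1.
have s10 : 0 < s - 1 by rewrite subr_gt0.
have V0 : 0 <= V by rewrite -lee_fin -muD.
have weak_le (a : R) : 0 < a -> _ := weak_type_integral_le s1 B0 ^~ weak.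
(* for V = 0 or B = 0 the balancing height is not a positive real *)
move: V0; rewrite le_eqVlt => /predU1P[V0|V0].
  rewrite null_set_integral ?lee_fin ?mulr_ge0 ?powR_ge0//; last first.
    by rewrite [LHS]muD -V0.
  by apply/measurable_EFinP; exact: measurable_funTS.
move: B0; rewrite le_eqVlt => /predU1P[B0|B0].
  (* the second term is zero, and the first is e for the height e / V *)
  rewrite -B0 mulr0 mul0r mulr0; apply/lee_addgt0Pr => e e0.
  rewrite add0e (le_trans (weak_le (e / V) (divr_gt0 e0 V0)))//.
  by rewrite -B0 powR0 ?gt_eqF// mul0r adde0 muD -EFinM divfK ?gt_eqF.
pose k : R := (s - 1)^-1 `^ s^-1.
have k0 : 0 < k by rewrite powR_gt0 ?invr_gt0.
pose a : R := k * B * V `^ (- s^-1).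
have a0 : 0 < a by rewrite !mulr_gt0// powR_gt0.
have aV : a * V = k * B * V `^ (1 - s^-1).
  rewrite /a -mulrA powRD ?(gt_eqF V0) ?implybT// powRr1 ?(ltW V0)//.
  by rewrite (mulrC V).
apply: (le_trans (weak_le a a0)).
rewrite muD -EFinM -EFinD lee_fin -/k -aV mulr_natl mulr2n lerD2l.
have -> : a `^ (1 - s) = a * ((s - 1) * B `^ (- s) * V).
  rewrite powRD ?(gt_eqF a0) ?implybT// powRr1 ?(ltW a0)//; congr (_ * _).
  rewrite /a !powRM ?powR_ge0 ?mulr_ge0 ?(ltW k0) ?(ltW B0)//.
  rewrite /k -!powRrM mulrN mulVf ?gt_eqF// mulrNN mulVf ?gt_eqF//.
  by rewrite powR_inv1 ?invr_ge0 ?(ltW s10)// invrK powRr1// ltW.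
rewrite powRN.
have Bs : B `^ s != 0 by rewrite gt_eqF// powR_gt0.
rewrite le_eqVlt; apply/orP; left; apply/eqP; field.
by rewrite Bs gt_eqF.
Qed.

End weak_type.

(** * Weak Lebesgue spaces on sets of finite measure *)

Section weak_Lebesgue.
Context d (T : measurableType d) (R : realType).
Variable mu : {sigma_finite_measure set T -> \bar R}.
Variables (D : set T) (f : T -> R).
Hypotheses (mD : measurable D) (mf : measurable_fun setT f).

(** Apply the balanced bound to [h = |f|^q1], which satisfies a weak bound with
    exponent [s = q2 / q1] and constant [B = A^q1], and take [q1]-th roots. *)
Lemma Lebesgue_le_weak_Lebesgue (q1 q2 A V : R) : 1 <= q1 -> q1 < q2 ->
  0 <= A -> mu D = V%:E ->
  (forall l : R, (0 < l)%R ->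
    ((l `^ q2)%:E * mu (D `&` [set y | (l < `|f y|)%R])) `^ q2^-1 <= A%:E)%E ->
  ((\int[mu]_(y in D) (`|f y| `^ q1)%:E) `^ q1^-1 <=
   (2 * (q1 / (q2 - q1)) `^ q2^-1 * (A * V `^ (q1^-1 - q2^-1)))%:E)%E.
Proof.
move=> q11 q12 A0 muD weak.
have q10 : 0 < q1 by exact: lt_le_trans q11.
have q20 : 0 < q2 by exact: lt_trans q12.
have V0 : 0 <= V by rewrite -lee_fin -muD.
have s1 : 1 < q2 / q1 by rewrite ltr_pdivlMr// mul1r.
have weak1 (t : R) : (0 < t) ->
    (mu (D `&` [set x | (t < `|f x| `^ q1)%R]) <=
     ((A `^ q1 / t) `^ (q2 / q1))%:E)%E.
  move=> t0; pose l : R := t `^ q1^-1.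
  have l0 : 0 < l by rewrite powR_gt0.
  have tE : t = l `^ q1 by rewrite -powRrM mulVf ?gt_eqF// powRr1// ltW.
  have -> : D `&` [set x | t < `|f x| `^ q1] = D `&` [set x | l < `|f x|].
    congr (_ `&` _); apply/seteqP; split=> x /=; rewrite tE => lx.
      rewrite ltNge; apply/negP => xl; move: lx; rewrite ltNge => /negP; apply.
      by apply: ge0_ler_powR; rewrite ?nnegrE ?(ltW q10) ?(ltW l0).
    by apply: gt0_ltr_powR; rewrite ?nnegrE ?(ltW l0).
  have lq2 : 0 < l `^ q2 by rewrite powR_gt0.
  have -> : (A `^ q1 / t) `^ (q2 / q1) = (l `^ q2)^-1 * A `^ q2.
    have q21 : q1 * (q2 / q1) = q2 by rewrite mulrC divfK ?gt_eqF.
    rewrite tE powRM ?invr_ge0 ?powR_ge0// -!powRN -!powRrM mulNr q21.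
    by rewrite mulrC.
  rewrite EFinM lee_pdivlMl//.
  (* raise the hypothesis at l to the power q2 *)
  have := weak _ l0; set m := (X in (X `^ _ <= _)%E) => mA.
  have m0 : (0 <= m)%E by rewrite mule_ge0// lee_fin ltW.
  have mE : m = ((m `^ q2^-1) `^ q2)%E.
    by rewrite -poweRrM mulVf ?gt_eqF// poweRe1.
  apply: (@le_trans _ _ m); first by [].
  rewrite mE -poweR_EFin; apply: gt0_ler_poweR;
    rewrite ?(ltW q20)// in_itv/= leey andbT ?poweR_ge0// lee_fin.
have mh : measurable_fun setT (fun x => `|f x| `^ q1).
  apply: (@measurableT_comp _ _ _ _ _ _ (@powR R ^~ q1)) => //.
  exact: measurableT_comp.
have := weak_type_integral_balanced mD mh (fun x => powR_ge0 _ _) s1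
  (powR_ge0 A q1) muD weak1.
set I := (\int[mu]_(x in D) _)%E => leI.
have I0 : (0 <= I)%E by apply: integral_ge0 => x _; rewrite lee_fin powR_ge0.
have q1V : 0 <= q1^-1 by rewrite invr_ge0 ltW.
apply: (@le_trans _ _ ((2 * (((q2 / q1 - 1)^-1 `^ (q2 / q1)^-1 * A `^ q1) *
    V `^ (1 - (q2 / q1)^-1)))%:E `^ q1^-1)%E).
  apply: gt0_ler_poweR => //; rewrite in_itv/= leey andbT// (le_trans I0)//.
rewrite poweR_EFin lee_fin; set c : R := (q1 / (q2 - q1)) `^ q2^-1.
rewrite !powRM ?mulr_ge0 ?powR_ge0//.
rewrite -!powRrM mulfV ?gt_eqF// powRr1// mulrBl mul1r -mulrA.
have -> : (q2 / q1)^-1 / q1 = q2^-1 by field; rewrite !gt_eqF.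
have -> : (q2 / q1 - 1)^-1 = q1 / (q2 - q1).
  by field; rewrite !gt_eqF// subr_gt0.
(* what remains is 2 ^ (1 / q1) <= 2, from 1 <= q1 *)
rewrite -/c -!mulrA ler_wpM2r ?mulr_ge0 ?powR_ge0//.
by apply: le_trans (ler1_powR _ _) _; rewrite ?invf_le1 ?ler1n.
Qed.

End weak_Lebesgue.

(** * Morrey norms *)

Section normalized.
Context d (T : measurableType d) (R : realType).
Variable mu : {sigma_finite_measure set T -> \bar R}.
Variables (D : set T) (f : T -> R).
Hypotheses (mD : measurable D) (mf : measurable_fun setT f).

(** Multiplying the embedding on [D] by [mu D ^ (1 / p - 1 / q1)] turns its
    factor [mu D ^ (1 / q1 - 1 / q2)] into the weight [mu D ^ (1 / p - 1 / q2)]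
    of the weak norm.  In the two degenerate cases the left-hand side is [0]:
    for [mu D = 0] an infinite weight multiplies a zero integral, and for
    [mu D] infinite the weight is [0]. *)
Lemma local_morrey_le_weak (p q1 q2 : R) : 1 <= q1 -> q1 < q2 -> q2 <= p ->
  ((mu D `^ (q1^-1 - p^-1))^-1 *
     (\int[mu]_(y in D) (`|f y| `^ q1)%:E) `^ q1^-1 <=
   (2 * (q1 / (q2 - q1)) `^ q2^-1)%:E * ((mu D `^ (q2^-1 - p^-1))^-1 *
     ereal_sup [set ((l `^ q2)%:E *
         mu [set y | D y /\ (l < `|f y|)%R]) `^ q2^-1
       | l in [set l : R | (0 < l)%R]]))%E.
Proof.
move=> q11 q12 q2p.
have q10 : 0 < q1 by exact: lt_le_trans q11.
have q20 : 0 < q2 by exact: lt_trans q12.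
have p0 : 0 < p by exact: lt_le_trans q2p.
have q1p : 0 < q1^-1 - p^-1.
  by rewrite subr_gt0 ltf_pV2 ?posrE// (lt_le_trans q12).
set C := 2 * _; set W := ereal_sup _.
have C0 : 0 < C by rewrite mulr_gt0// powR_gt0// divr_gt0// subr_gt0.
have weak (l : R) : 0 < l ->
    (((l `^ q2)%:E * mu (D `&` [set y | (l < `|f y|)%R])) `^ q2^-1 <= W)%E.
  by move=> l0; apply: ereal_sup_ubound; exists l.
have W0 : (0 <= W)%E by apply: le_trans (weak 1 ltr01); exact: poweR_ge0.
have RHS0 : (0 <= C%:E * ((mu D `^ (q2^-1 - p^-1))^-1 * W))%E.
  by rewrite !mule_ge0 ?lee_fin ?inve_ge0 ?poweR_ge0 ?(ltW C0).
have [muDoo|muDoo] := eqVneq (mu D) +oo%E.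
  rewrite muDoo in RHS0 *.
  by rewrite (poweRyr (lt0r_neq0 q1p)) invey mul0e.
have muDfin : mu D \is a fin_num by rewrite ge0_fin_numE// ltey.
pose V : R := fine (mu D).
have muD : mu D = V%:E by rewrite fineK.
have : 0 <= V by rewrite fine_ge0.
rewrite le_eqVlt => /predU1P[V0|V0].
  rewrite null_set_integral; last 3 first.
  - by [].
  - apply/measurable_EFinP/measurable_funTS.
    apply: (@measurableT_comp _ _ _ _ _ _ (@powR R ^~ q1)) => //.
    exact: measurableT_comp.
  - by rewrite [LHS]muD -V0.
  by rewrite poweR0r ?gt_eqF ?invr_gt0// mule0.
have V_inv (r : R) : ((V%:E `^ r)^-1 = (V `^ (- r))%:E)%E.
  by rewrite poweR_EFin inver gt_eqF ?powR_gt0// powRN.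
(* if W is infinite, so is the right-hand side *)
move: W0 weak RHS0; rewrite muD !V_inv.
case: W => [A| |]// A0 weak _; last first.
  by rewrite gt0_muley ?lte_fin ?powR_gt0// gt0_muley ?lte_fin// leey.
have := Lebesgue_le_weak_Lebesgue mD mf q11 q12 A0 muD weak.
have Vp0 : (0 <= (V `^ (- (q1^-1 - p^-1)))%:E)%E by rewrite lee_fin powR_ge0.
move=> /(lee_wpmul2l Vp0) /le_trans; apply.
rewrite -!EFinM lee_fin -/C mulrCA ler_wpM2l ?(ltW C0)// mulrCA mulrC.
rewrite ler_wpM2r// -powRD ?(gt_eqF V0) ?implybT// le_eqVlt.
by apply/orP; left; apply/eqP; congr (_ `^ _); ring.
Qed.

End normalized.

(** Tonelli's theorem in the layer cake formula requires sigma-finiteness. *)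
HB.instance Definition _ (R : realType) (n : nat) :=
  Measure_isSigmaFinite.Build _ _ _ (@lebesgue R n)
    (completed_measure_extension_sigma_finite
      (sigma_finiteT (borel_lebesgue R n))).

Lemma measurable_cube (R : realType) (n : nat) (x : euclidean R n) (r : R) :
  measurable (cube x r).
Proof.
(* Borel sets are Lebesgue measurable *)
apply: caratheodory_measurable_mu_ext.
rewrite (_ : cube x r = \bigcap_(i in [set: 'I_n])
    (fun y : n.-tuple (measurableTypeR R) => tnth y i) @^-1`
      `](tnth x i : R) - r, (tnth x i : R) + r[); last first.
  apply/seteqP; split=> y /=.
    by move=> xy i _ /=; rewrite in_itv/= -ltr_distl; exact: xy.
  by move=> xy i; have := xy i Logic.I; rewrite /= in_itv/= -ltr_distl.
apply: fin_bigcap_measurable => // i _.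
rewrite -[X in measurable X]setTI; apply: measurable_tnth => //.
Qed.

Theorem theorem2p1 (R : realType) (n : nat) (p q1 q2 : R)
    (n_gt0 : (0 < n)%N) (q1_ge1 : 1 <= q1) (q1q2 : q1 < q2) (q2p : q2 <= p) :
  @weak_morrey R n p q2 `<=` @morrey R n p q1 /\
  forall f : euclidean R n -> R, @weak_morrey R n p q2 f ->
    (morrey_norm p q1 f <=
     (2 * (q1 / (q2 - q1)) `^ q2^-1)%:E * weak_morrey_norm p q2 f)%E.
Proof.
have C0 : 0 <= 2 * (q1 / (q2 - q1)) `^ q2^-1 by rewrite mulr_ge0 ?powR_ge0.
have norm_le (f : euclidean R n -> R) : measurable_fun setT f ->
    (morrey_norm p q1 f <=
     (2 * (q1 / (q2 - q1)) `^ q2^-1)%:E * weak_morrey_norm p q2 f)%E.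
  move=> mf; apply: ge_ereal_sup => _ [x _ [r r0 <-]].
  apply: le_trans (local_morrey_le_weak (@lebesgue R n)
    (measurable_cube x r) mf q1_ge1 q1q2 q2p) _.
  apply: lee_wpmul2l; first by rewrite lee_fin.
  by apply: ereal_sup_ubound; exists x => //; exists r.
split=> [f [mf weakf]|f [mf _]]; last exact: norm_le.
split=> //; apply: le_lt_trans (norm_le _ mf) _.
apply: lte_mul_pinfty => //; rewrite lee_fin.
Qed.
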